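(* Suppose that $\mathcal{H}$ is a cancellative $3$-graph on $n$ vertices. Then \[ |\mathcal{H}|\le\frac{\left(n^2-2|\partial\mathcal{H}|\right)|\partial\mathcal{H}|}{3n}+3n^2. \]
   Context: A $3$-graph $\mathcal{H}$ is a finite vertex set with a set of $3$-element subsets (edges). The shadow is $\partial\mathcal{H}=\{A\in\binom{V(\mathcal{H})}{2}: A\subset B\text{ for some }B\in\mathcal{H}\}$. $\mathcal{T}_3$ is the collection of all $3$-graphs on at most $5$ vertices with $3$ edges $A,B,C$ such that $A\triangle B\subset C$; a $3$-graph is cancellative iff it contains no member of $\mathcal{T}_3$ as a (not necessarily induced) subgraph. *)

(* Defs.v *)
From mathcomp Require Import all_boot all_order all_algebra.

Set Implicit Arguments.
Unset Strict Implicit.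
Unset Printing Implicit Defensive.

(* A 3-graph with vertex set V is given by its edge set E : {set {set V}};
   isolated vertices are allowed, and its number of vertices is #|V|. *)
Definition three_graph (V : finType) (E : {set {set V}}) : Prop :=
  forall e, e \in E -> #|e| = 3.

Definition shadow (V : finType) (E : {set {set V}}) : {set {set V}} :=
  [set A : {set V} | (#|A| == 2) && [exists B in E, A \subset B]].

Definition symdiff (V : finType) (A B : {set V}) : {set V} :=
  (A :\: B) :|: (B :\: A).

Definition in_T3 (U : finType) (F : {set {set U}}) : Prop :=
  [/\ three_graph F, #|U| <= 5, #|F| = 3 &
      exists A B C : {set U},
        F = [set A; B; C] /\ symdiff A B \subset C].

Definition contains (V : finType) (E : {set {set V}})
    (U : finType) (F : {set {set U}}) : Prop :=
  exists2 f : U -> V, injective f & forall e, e \in F -> f @: e \in E.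

Definition cancellative (V : finType) (E : {set {set V}}) : Prop :=
  forall (U : finType) (F : {set {set U}}), in_T3 F -> ~ contains E F.

(* Main.v *)
Require Import Defs.
From mathcomp Require Import all_boot all_order all_algebra.
From mathcomp Require Import ring lra.

Import Order.TTheory GRing.Theory Num.Theory.
Local Open Scope ring_scope.

(** Write d(uv) for the codegree of a pair and D(a) for the degree of a in the
    shadow.  Being cancellative means that the common neighbourhood N(uv) of any
    pair is independent in the shadow.  Hence for every edge vab the set N(vb),
    which contains a, misses the shadow neighbourhood of a, and
    d(vb) <= n - D(a).  Averaging over b in N(va) and summing over the ordered
    shadow pairs (v,a) gives
      2 n |shadow| - \sum_a D(a)^2 >= \sum_(v,a,b) d(vb) / d(va) >= 6 |H|,
    where the last step pairs (v,a,b) with (v,b,a) and uses x/y + y/x >= 2.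
    Cauchy-Schwarz, \sum_a D(a)^2 >= 4 |shadow|^2 / n, finishes the proof. *)

(** Double counting by the set of entries: with [f] sending a tuple to that set, ordered pairs are
    counted over the shadow and ordered triples over the edges. *)
Lemma sum_mem_fibers (T I : finType) (f : T -> I) (S : {set I}) :
  (\sum_x (f x \in S) = \sum_(A in S) #|[set x | f x == A]|)%N.
Proof.
transitivity (\sum_(x | f x \in S) 1)%N.
  by rewrite [RHS]big_mkcond; apply: eq_bigr => x _; case: (_ \in _).
rewrite (partition_big f (mem S)) //; apply: eq_bigr => A AS.
rewrite -sum1_card; apply: eq_bigl => x; rewrite inE.
by case: eqP => [->|]; rewrite ?andbF // andbT.
Qed.

Section Adjacency.
Variables (V : finType) (H : {set {set V}}).

Definition triple (u v w : V) : bool := [set u; v; w] \in H.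
Definition adj (u v : V) : bool := [set u; v] \in shadow H.
Definition codeg (u v : V) : nat := #|[set w | triple u v w]|.
Definition sdeg (u : V) : nat := #|[set v | adj u v]|.

Lemma tripleAC u v w : triple u v w = triple u w v.
Proof. by rewrite /triple setUAC. Qed.

Lemma adjC u v : adj u v = adj v u.
Proof. by rewrite /adj setUC. Qed.

Lemma adjP u v : reflect (u != v /\ exists2 C, C \in H & [set u; v] \subset C)
                         (adj u v).
Proof.
rewrite /adj inE cards2 eqSS eqb1.
apply: (iffP andP) => -[uv]; first by move/exists_inP.
by move=> CP; split=> //; apply/exists_inP.
Qed.

Lemma codeg_gt0 u v w : triple u v w -> (0 < codeg u v)%N.
Proof. by move=> uvw; apply/card_gt0P; exists w; rewrite inE. Qed.

Lemma card_ordered_pairs : (\sum_u \sum_v adj u v = 2 * #|shadow H|)%N.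
Proof.
rewrite pair_big /= (sum_mem_fibers _ _ (fun p => [set p.1; p.2])) mulnC -sum_nat_const.
apply: eq_bigr => A; rewrite inE => /andP[/cards2P[a [b [ab eA]]] _].
transitivity #|[set (a, b); (b, a)]|; last first.
  by rewrite cards2 xpair_eqE (negPf ab).
apply: eq_card => -[u v].
rewrite !inE /= !xpair_eqE eA; case: eqP => [e|e].
  have: u \in [set a; b] by rewrite -e !inE eqxx.
  have: v \in [set a; b] by rewrite -e !inE eqxx orbT.
  have: a \in [set u; v] by rewrite e !inE eqxx.
  have: b \in [set u; v] by rewrite e !inE eqxx orbT.
  rewrite !inE ![a == _]eq_sym ![b == _]eq_sym.
  by do 4![case: (_ == _) => //].
by apply/esym/negP => /orP[] /andP[/eqP ua /eqP vb]; case: e; rewrite ua vb // setUC.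
Qed.

Lemma sum_sdeg : (\sum_u sdeg u = 2 * #|shadow H|)%N.
Proof.
rewrite -card_ordered_pairs; apply: eq_bigr => u _.
by rewrite /sdeg -sum1_card big_mkcond; apply: eq_bigr => v _; rewrite inE; case: adj.
Qed.

Hypothesis H3 : three_graph H.

Lemma triple_uniq u v w : triple u v w -> uniq [:: u; v; w].
Proof.
move=> /H3 /eqP; apply: contraLR => uvw; rewrite neq_ltn; apply/orP; left.
have -> : [set u; v; w] = [set x in [:: u; v; w]].
  by apply/setP => x; rewrite !inE orbA.
rewrite cardsE; have := card_size [:: u; v; w].
by rewrite leq_eqVlt => /orP[/eqP/card_uniqP|//]; rewrite (negPf uvw).
Qed.

Lemma triple_adj u v w : triple u v w -> adj u v.
Proof.
move=> T; apply/adjP; split; last by exists [set u; v; w]; rewrite // subsetUl.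
by have /and3P[] := triple_uniq _ _ _ T; rewrite inE negb_or => /andP[].
Qed.

Lemma card_ordered_triples : (6 * #|H| <= \sum_u \sum_v \sum_w triple u v w)%N.
Proof.
under eq_bigr do rewrite pair_big /=.
rewrite pair_big /= (sum_mem_fibers _ _ (fun p => [set p.1; p.2.1; p.2.2])).
rewrite mulnC -sum_nat_const; apply: leq_sum => A AH.
have [a [b [c [ab ac bc eA]]]] : exists a b c,
    [/\ a != b, a != c, b != c & A = [set a; b; c]].
  have := H3 _ AH; rewrite cardE; have := enum_uniq A.
  case e: (enum A) => [|a [|b [|c []]]] //= + _; rewrite !inE negb_or.
  case/and3P => /andP[ab ac] bc _; exists a, b, c; split=> //.
  by apply/setP => x; rewrite -mem_enum e !inE orbA.
(* The six orderings of the edge are distinct and all lie in the fibre over [A], which bounds its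
   size from below. *)
pose s := [:: (a, (b, c)); (a, (c, b)); (b, (a, c));
              (b, (c, a)); (c, (a, b)); (c, (b, a))].
have us : uniq s.
  rewrite /= !inE !xpair_eqE !eqxx ![b == a]eq_sym ![c == a]eq_sym ![c == b]eq_sym.
  by rewrite (negPf ab) (negPf ac) (negPf bc).
rewrite -(card_uniqP us : #|s| = 6%N); apply/subset_leq_card/subsetP => p ps.
rewrite inE /= eA; apply/eqP/setP => x; move: ps.
by rewrite !inE; do ![case/orP]; move/eqP=> -> /=;
  case: (x == a); case: (x == b); case: (x == c).
Qed.

Hypothesis Hcanc : cancellative H.

(** If some edge [C] contained [w] and [w'], then [A = uvw] and [B = uvw'] would have symmetric
    difference {w, w'} inside [C], so that [A], [B], [C] form a member of T_3. *)
Lemma common_neighbours_independent u v w w' :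
  triple u v w -> triple u v w' -> ~~ adj w w'.
Proof.
move=> Tw Tw'; apply/negP => /adjP[ww' [C CH wC]].
set A := [set u; v; w]; set B := [set u; v; w'].
pose X := A :|: B :|: C.
have [AX BX CX] : [/\ A \subset X, B \subset X & C \subset X].
  split; rewrite /X ?subsetUr //; last exact: subset_trans (subsetUr A B) (subsetUl _ _).
  exact: subset_trans (subsetUl A B) (subsetUl _ _).
(* [in_T3] bounds the size of the whole vertex type, so the three edges are pulled back along the
   inclusion [f] of their union [X]. *)
pose f : {x | x \in X} -> V := val.
pose g (E : {set V}) := f @^-1: E.
have fg (E : {set V}) : E \subset X -> f @: g E = E.
  move=> /subsetP EX; apply/setP => x; apply/imsetP/idP => [[y]|xE].
    by rewrite inE => yE ->.
  by exists (exist _ x (EX x xE)); rewrite ?inE.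
have finj : injective f by exact: val_inj.
have cardg E : E \in H -> E \subset X -> #|g E| = 3%N.
  by move=> EH EX; rewrite -(card_imset _ finj) fg // H3.
have [wC' w'C] : w \in C /\ w' \in C.
  by split; apply: (subsetP wC); rewrite !inE eqxx ?orbT.
have /and3P[] := triple_uniq _ _ _ Tw; rewrite !inE negb_or => /andP[uv uw] vw _.
have /and3P[] := triple_uniq _ _ _ Tw'; rewrite !inE negb_or => /andP[_ uw'] vw' _.
have AB : A != B.
  apply/eqP => /setP/(_ w); rewrite !inE eqxx (negPf ww') ![w == _]eq_sym.
  by rewrite (negPf uw) (negPf vw).
have AC : A != C.
  apply/eqP => /setP/(_ w'); rewrite w'C !inE ![w' == _]eq_sym.
  by rewrite (negPf ww') (negPf uw') (negPf vw').
have BC : B != C.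
  apply/eqP => /setP/(_ w); rewrite wC' !inE (negPf ww') ![w == _]eq_sym.
  by rewrite (negPf uw) (negPf vw).
have gneq (E E' : {set V}) : E \subset X -> E' \subset X -> E != E' -> g E != g E'.
  by move=> EX EX'; apply: contraNneq => e; rewrite -(fg E) // e fg.
pose F := [set g A; g B; g C].
have FE e : e \in F -> exists E, [/\ E \in H, E \subset X & e = g E].
  by rewrite !inE -orbA => /or3P[] /eqP ->; [exists A|exists B|exists C].
apply: (Hcanc _ F); last first.
  by exists f => // e /FE[E [EH EX ->]]; rewrite fg.
split.
- by move=> e /FE[E [EH EX ->]]; exact: cardg.
- rewrite card_sig.
  (* Besides [u], [v], [w], [w'], the union contains at most the third vertex of [C]: 4 + 1 = 5. *)
  have XE : X \subset [set u; v; w; w'] :|: (C :\: [set w; w']).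
    apply/subsetP => x; rewrite !inE.
    by case: (x == u); case: (x == v); case: (x == w); case: (x == w').
  have := leq_trans (subset_leq_card XE) (leq_card_setU _ _).
  rewrite cardsD (setIidPr wC) (H3 _ CH) cards2 ww'.
  have := leq_card_setU [set u; v; w] [set w']; rewrite cards1 (H3 _ Tw) => h1 h2.
  have -> : #|[pred x in X]| = #|X| by apply: eq_card.
  by apply: leq_trans h2 _; rewrite -[5%N]/(4 + 1)%N leq_add ?(leq_of_leqif h1).
- rewrite /F setUC cardsU1 cards2 !inE (gneq A B) //.
  by rewrite ![g C == _]eq_sym (negPf (gneq _ _ AX CX AC)) (negPf (gneq _ _ BX CX BC)).
- exists (g A), (g B), (g C); split => //.
  apply/subsetP => x; rewrite !inE => h.
  have : (f x == w) || (f x == w').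
    by move: h; case: (f x == u); case: (f x == v); case: (f x == w);
      case: (f x == w').
  by case/orP => /eqP ->.
Qed.

Lemma codeg_sdeg_le v a b : triple v a b -> (codeg v b + sdeg a <= #|V|)%N.
Proof.
move=> T; rewrite /codeg /sdeg -cardsUI -[X in (_ <= X)%N]addn0 leq_add ?max_card //.
rewrite leqn0 cards_eq0; apply/eqP/setP => x; rewrite !inE.
apply/negP => /andP[T' ax].
have T2 : triple v b a by rewrite tripleAC.
by have := common_neighbours_independent _ _ _ _ T2 T'; rewrite ax.
Qed.

Lemma sum_codeg_ratio_le v a :
  \sum_b (triple v a b)%:R * ((codeg v b)%:R / (codeg v a)%:R) <=
    (adj v a)%:R * (#|V|%:R - (sdeg a)%:R) :> rat.
Proof.
have sdegV : (sdeg a)%:R <= #|V|%:R :> rat by rewrite ler_nat max_card.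
(* Clearing the denominator requires a positive codegree of [va]. If no edge contains [va], the left
   side vanishes and the right side is nonnegative by [sdegV]. *)
have [/existsP[b0 T0]|] := boolP [exists b, triple v a b]; last first.
  rewrite negb_exists => /forallP nT; rewrite big1 => [|b _].
    by rewrite mulr_ge0 ?ler0n ?subr_ge0.
  by rewrite (negPf (nT b)) mul0r.
rewrite (triple_adj _ _ _ T0) mul1r.
have d0 : 0 < (codeg v a)%:R :> rat by rewrite ltr0n (codeg_gt0 _ _ _ T0).
under eq_bigr do rewrite mulrA.
rewrite -mulr_suml ler_pdivrMr //.
(* With the codegree spread out as a sum of indicators, both sides are sums over [b] and
   [codeg_sdeg_le] applies term by term. *)
have -> : (codeg v a)%:R = \sum_b (triple v a b)%:R :> rat.
  rewrite -natr_sum /codeg -sum1_card big_mkcond; congr (_%:R).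
  by apply: eq_bigr => b _; rewrite inE; case: triple.
rewrite mulr_sumr; apply: ler_sum => b _; case: (boolP (triple v a b)) => T /=; last first.
  by rewrite mulr0 mul0r.
by rewrite mul1r mulr1 lerBrDr -natrD ler_nat codeg_sdeg_le.
Qed.

Lemma ordered_triples_le_codeg_ratio :
  \sum_v \sum_a \sum_b (triple v a b)%:R <=
  \sum_v \sum_a \sum_b (triple v a b)%:R * ((codeg v b)%:R / (codeg v a)%:R) :> rat.
Proof.
(* After doubling, one copy of the right side has [a] and [b] exchanged, so that each ratio meets
   its reciprocal. *)
apply: ler_sum => v _; rewrite -(ler_pM2l (ltr0n rat 2)) [leRHS]mulr_natl mulr2n.
rewrite [X in _ <= _ + X]exchange_big -big_split mulr_sumr; apply: ler_sum => a _ /=.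
rewrite -big_split mulr_sumr; apply: ler_sum => b _ /=.
rewrite (tripleAC v b a); case: (boolP (triple v a b)) => T /=; last by lra.
rewrite !mul1r mulr1.
have x0 : 0 < (codeg v a)%:R :> rat by rewrite ltr0n (codeg_gt0 _ _ _ T).
have y0 : 0 < (codeg v b)%:R :> rat.
  by rewrite ltr0n (codeg_gt0 _ _ a) // tripleAC.
move: x0 y0; set x : rat := _%:R; set y : rat := _%:R => x0 y0.
have -> : y / x + x / y = 2 + (x - y) ^+ 2 / (x * y) by field; rewrite !gt_eqF.
by rewrite lerDl divr_ge0 ?sqr_ge0 // mulr_ge0 // ltW.
Qed.

Lemma edges_sdeg_sqr_le :
  6 * #|H|%:R + \sum_a (sdeg a)%:R ^+ 2 <= 2 * #|shadow H|%:R * #|V|%:R :> rat.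
Proof.
have h1 : 6 * #|H|%:R <= \sum_v \sum_a \sum_b (triple v a b)%:R :> rat.
  have := card_ordered_triples; rewrite -(ler_nat rat) natrM natr_sum => h.
  apply: le_trans h _; apply: ler_sum => v _; rewrite natr_sum; apply: ler_sum => a _.
  by rewrite natr_sum.
rewrite -lerBrDr; apply: le_trans h1 _; apply: le_trans ordered_triples_le_codeg_ratio _.
apply: (@le_trans _ _ (\sum_v \sum_a (adj v a)%:R * (#|V|%:R - (sdeg a)%:R))).
  by apply: ler_sum => v _; apply: ler_sum => a _; exact: sum_codeg_ratio_le.
(* For fixed [a], summing over [v] first turns the weights [adj v a] into the factor [sdeg a]; both
   sides then become sums over [a]. *)
rewrite exchange_big /= -natrM -sum_sdeg natr_sum mulr_suml -sumrB; apply: ler_sum => a _.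
rewrite -mulr_suml; have -> : \sum_v (adj v a)%:R = (sdeg a)%:R :> rat.
  rewrite -natr_sum /sdeg -sum1_card; congr (_%:R).
  by rewrite [RHS]big_mkcond; apply: eq_bigr => v _; rewrite inE adjC; case: adj.
by rewrite mulrBr expr2.
Qed.

End Adjacency.

(** The nonnegative sum of the squares of [N * x i - S] equals [N] times the right side minus the
    left. Cancelling [N] requires a nonempty index type, hence the separate case. *)
Lemma sqr_sum_le_card (R : realFieldType) (I : finType) (x : I -> R) :
  (\sum_i x i) ^+ 2 <= #|I|%:R * \sum_i x i ^+ 2.
Proof.
have [I0|In0] := eqVneq #|I| 0%N.
  rewrite I0 mul0r big1 ?expr0n // => i; by have := card0_eq I0 i.
set S := \sum_i x i; set N : R := #|I|%:R.
have N0 : 0 < N by rewrite ltr0n lt0n.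
have : 0 <= \sum_i (N * x i - S) ^+ 2 by apply: sumr_ge0 => i _; exact: sqr_ge0.
have -> : \sum_i (N * x i - S) ^+ 2 = N * (N * \sum_i x i ^+ 2 - S ^+ 2).
  transitivity (\sum_i (N ^+ 2 * x i ^+ 2 - 2 * N * S * x i + S ^+ 2)).
    by apply: eq_bigr => i _; ring.
  rewrite big_split sumrB /= -!mulr_sumr sumr_const -/S -mulr_natr -/N.
  ring.
by rewrite pmulr_rge0 // subr_ge0.
Qed.

Theorem theorem4p6 (V : finType) (H : {set {set V}}) (n : nat)
  (H3 : three_graph H) (Hcanc : cancellative H) (Hn : #|V| = n) :
  (#|H|%:R : rat) <=
    (n%:R ^+ 2 - 2 * #|shadow H|%:R) * #|shadow H|%:R / (3 * n%:R)
    + 3 * n%:R ^+ 2.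
Proof.
have := edges_sdeg_sqr_le _ _ H3 Hcanc.
have := sqr_sum_le_card _ _ (fun a => (sdeg _ H a)%:R : rat).
rewrite -natr_sum sum_sdeg natrM Hn.
set s : rat := #|shadow H|%:R; set h : rat := #|H|%:R; set Q := \sum_a _ => cs main.
(* For [n = 0] the quotient is 0 by the convention on inverses, and [main] reads 6 h + Q <= 0, which
   forces h <= 0. *)
have [n0|n0] := posnP n.
  have Q0 : 0 <= Q by apply: sumr_ge0 => a _; exact: sqr_ge0.
  by move: main; rewrite n0 !mulr0 invr0 expr0n /= !mulr0 addr0; lra.
move: cs main; have : 0 < n%:R :> rat by rewrite ltr0n.
set m : rat := n%:R => m0 cs main.
suff : h <= (m ^+ 2 - 2 * s) * s / (3 * m) by have := sqr_ge0 m; lra.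
(* Multiply [main] by [m] and bound m Q below by 4 s^2 using [cs]: 6 h m <= 2 s m^2 - 4 s^2, which
   is twice the goal. *)
rewrite ler_pdivlMr ?mulr_gt0 //; nra.
Qed.
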